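(* Let $\mathcal{J}$ be a finite group and $Y_1,\dots,Y_n$ ($n\ge1$) finite pairwise disjoint $\mathcal{J}$-sets on each of which $\mathcal{J}$ acts effectively freely. Let $Y=Y_1\star\cdots\star Y_n$ and let $Y/\mathcal{J}$ be the quotient simplicial poset. Then all eigenvalues of $\Delta_{n-1}(Y/\mathcal{J})$ are integers.
   Context: The action of $\mathcal{J}$ on a set $U$ is effectively free if the induced action of $\mathcal{J}/K$ on $U$ is free, where $K$ is the kernel of the action. $Y=Y_1\star\cdots\star Y_n$ is the simplicial complex (join) on vertex set $\bigsqcup Y_i$ whose faces are the sets containing at most one vertex from each $Y_i$; $\mathcal{J}$ acts on faces vertexwise, and $Y/\mathcal{J}$ is the simplicial poset (regular CW complex with simplicial closed cells) whose $j$-dimensional faces are the $\mathcal{J}$-orbits of $j$-dimensional faces of $Y$ (the empty face has dimension $-1$). Let $C_j$ be the complex vector space with orthonormal basis the $j$-dimensional faces of $Y/\mathcal{J}$, and $\partial_j:C_j\to C_{j-1}$ the boundary map: for a face $\sigma=\{y_{i_0},\dots,y_{i_j}\}$ with $y_{i_l}\in Y_{i_l}$, $i_0<\cdots<i_j$, $\partial_j[\sigma]=\sum_{l=0}^{j}(-1)^l[\sigma-\{y_{i_l}\}]$ (where $[\cdot]$ denotes the orbit); $C_j=0$ for $j<-1$ or $j>n-1$. The combinatorial Laplacian is $\Delta_j=\partial_j^t\partial_j+\partial_{j+1}\partial_{j+1}^t:C_j\to C_j$. *)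

(* Defs.v *)
From HB Require Import structures.
From mathcomp Require Import all_boot all_order all_algebra all_fingroup.
From mathcomp Require Import reals complex.
Set Implicit Arguments.
Unset Strict Implicit.
Unset Printing Implicit Defensive.
Import GroupScope GRing.Theory.
Local Open Scope nat_scope.
Local Open Scope ring_scope.

Section EffectivelyFree.

Variables (gT : finGroupType) (U : finType).

Definition free_action (aT : finGroupType) (D : {group aT})
    (to : action D U) : Prop :=
  forall u : U, 'C_D[u | to] = 1%g.

Definition action_kernel (to : {action gT &-> U}) : {group gT} :=
  'C([set: U] | to)%G.

(* Actions here are right actions; a left action becomes one through g^-1, with
   the same orbits, stabilisers and kernel.
   [to %% K] is the action of the quotient group [setT / K] induced by [to]. *)
Definition effectively_free (to : {action gT &-> U}) : Prop :=
  free_action (to %% action_kernel to)%act.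

Lemma effectively_freeP (to : {action gT &-> U}) :
  effectively_free to <->
  (forall u g, to u g = u -> forall v, to v g = v).
Proof.
have nK (g : gT) : g \in 'N(action_kernel to).
  rewrite inE; apply/subsetP=> _ /imsetP[k /astab_act Kk ->].
  rewrite !inE; apply/subsetP=> v _; rewrite inE.
  by rewrite conjgE !actM Kk ?inE // actKV.
have rK (u : U) : u \in 'Fix_to([set: gT] :&: action_kernel to).
  by apply/afixP=> x /setIP[_ /astab_act]; apply; rewrite inE.
have modE u g : (to %% action_kernel to)%act u (coset (action_kernel to) g) = to u g.
  by rewrite /= modactE ?nK ?rK ?in_setT.
split=> [free u g fixg v | free u].
  have gQ : coset (action_kernel to) g \in ([set: gT] / action_kernel to)%g.
    by rewrite mem_quotient ?in_setT.
  have : coset (action_kernel to) g \in [1 coset_of (action_kernel to)].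
    rewrite -(free u) in_setI gQ inE gQ inE sub1set inE.
    by apply/eqP; rewrite modE.
  move=> /set1P /coset_idr Kg.
  by rewrite (astab_act (Kg (nK g))) ?in_setT.
apply/trivgP/subsetP=> x /setIP[/morphimP[g Ng _ ->] cx].
have fixg : to u g = u.
  by rewrite -modE; apply: (astab_act cx); rewrite inE.
rewrite inE; apply/eqP/coset_id; rewrite !inE /=.
by apply/subsetP=> v _; rewrite !inE; apply/eqP/free/fixg.
Qed.

End EffectivelyFree.

Section QuotientComplex.

Variables (gT : finGroupType) (n : nat) (Y : 'I_n -> finType).
Variable (to : forall i, {action gT &-> Y i}).

(* The disjoint union of the Y i. *)
Definition vertex : finType := {i : 'I_n & Y i}.

Definition vertex_act (v : vertex) (g : gT) : vertex :=
  Tagged Y (to (tag v) (tagged v) g).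

Lemma vertex_act1 v : vertex_act v 1%g = v.
Proof. by case: v => i y; rewrite /vertex_act /= act1. Qed.

Lemma vertex_actM v : act_morph vertex_act v.
Proof. by move=> g h; rewrite /vertex_act /= actM. Qed.

Canonical vertex_action : {action gT &-> vertex} :=
  TotalAction vertex_act1 vertex_actM.

(* A face of the join: at most one vertex from each Y i. *)
Definition join_face (F : {set vertex}) : bool :=
  [forall v in F, forall w in F, (tag v == tag w) ==> (v == w)].

Definition face_orbit (F : {set vertex}) : {set {set vertex}} :=
  orbit (vertex_action^*)%act [set: gT] F.

(* Faces of the quotient are indexed by their number of vertices k, i.e. by
   dimension + 1, so that the empty face is in [quotient_faces 0]. *)
Definition quotient_faces (k : nat) : {set {set {set vertex}}} :=
  [set face_orbit F | F in [set F : {set vertex} | join_face F & #|F| == k]].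

Definition face_repr (O : {set {set vertex}}) : {set vertex} :=
  odflt set0 [pick F in O].

Variable (C : nzRingType).

Definition face_vector (k : nat) (O : {set {set vertex}}) :
    'cV[C]_#|quotient_faces k| :=
  \col_t (enum_val t == O)%:R.

(* If v = y_{i_l} with i_0 < ... < i_j, then l is the number of vertices of F
   lying in a Y i with i < i_l. *)
Definition vertex_rank (F : {set vertex}) (v : vertex) : nat :=
  #|[set w in F | (tag w < tag v)%N]|.

Definition face_boundary (j : nat) (F : {set vertex}) :
    'cV[C]_#|quotient_faces j| :=
  \sum_(v in F) (-1) ^+ vertex_rank F v *: face_vector j (face_orbit (F :\ v)).

(* The matrix of the boundary map from C_j to C_(j-1), acting on column
   vectors; it does not depend on [face_repr], see [boundaryE]. *)
Definition boundary (j : nat) :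
    'M[C]_(#|quotient_faces j|, #|quotient_faces j.+1|) :=
  \matrix_(t, s) face_boundary j (face_repr (enum_val s)) t 0.

(* The transpose is the adjoint, since the basis is orthonormal and the entries
   are integers. [eigenvalue] uses row vectors, which is harmless as the
   Laplacian is a symmetric matrix. *)
Definition laplacian (j : nat) : 'M[C]_#|quotient_faces j.+1| :=
  (boundary j)^T *m boundary j + boundary j.+1 *m (boundary j.+1)^T.

Lemma face_boundary_act j F g :
  face_boundary j ((vertex_action^*)%act F g) = face_boundary j F.
Proof.
rewrite /face_boundary /= /setact big_imset /=; last first.
  by move=> x y _ _ /(act_inj vertex_action).
apply: eq_bigr => v Fv; congr (_ *: face_vector j _).
  rewrite /vertex_rank; congr (_ ^+ _).
  rewrite -(card_imset [set w in F | (tag w < tag v)%N] (act_inj vertex_action g)).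
  apply: eq_card => w; rewrite inE; apply/andP/imsetP.
    by case=> /imsetP[x Fx ->] lt; exists x => //; rewrite inE Fx.
  by case=> x; rewrite inE => /andP[Fx lt] ->; split=> //; apply: imset_f.
rewrite /face_orbit.
have -> : [set vertex_act x g | x in F] :\ vertex_act v g
        = (vertex_action^*)%act (F :\ v) g.
  apply/setP=> w; rewrite !inE; apply/andP/imsetP.
    case=> ne /imsetP[x Fx Ew]; exists x => //; rewrite !inE Fx andbT.
    by apply: contraNneq ne => <-; rewrite Ew.
  case=> x; rewrite !inE => /andP[ne Fx] ->; split; last exact: imset_f.
  by apply: contraNneq ne => /(act_inj vertex_action) ->.
by apply: orbit_act; rewrite inE.
Qed.

Lemma boundaryE j F (s : 'I_#|quotient_faces j.+1|) :
  enum_val s = face_orbit F -> col s (boundary j) = face_boundary j F.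
Proof.
move=> sF; apply/colP=> t; rewrite !mxE sF /face_repr.
case: pickP => [G /orbitP[g _ <-]|/(_ F)]; last by rewrite orbit_refl.
by rewrite face_boundary_act.
Qed.

End QuotientComplex.

(* Main.v *)
(* Pulled back along the orbit map to functions on Y_1 x ... x Y_n, the top
   Laplacian becomes the sum over i of c_i^-1 B_i, where B_i sums a function over
   its i-th coordinate and c_i is the common size of the orbits on Y_i of the
   pointwise stabiliser of all the other Y_j.  The B_i commute and satisfy
   B_i^2 = |Y_i| B_i, so c_i^-1 B_i has eigenvalues 0 and |Y_i| / c_i, and c_i
   divides |Y_i|.  Hence every eigenvalue of the sum is a natural number. *)

From HB Require Import structures.
Require Import Defs.
From mathcomp Require Import all_boot all_order all_algebra all_fingroup.
From mathcomp Require Import reals complex.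
Set Implicit Arguments.
Unset Strict Implicit.
Unset Printing Implicit Defensive.
Import GRing.Theory Num.Theory.
Local Open Scope ring_scope.

(** Starting from [v], run through the operators and replace the current vector [w] by [A i w]
    whenever this is nonzero. By [A i (A i w) = A i w *+ m i] the new vector is an eigenvector of
    [A i] with eigenvalue [m i]; otherwise [A i] has eigenvalue 0 on [w]. Commutation preserves the
    eigenvalues found so far and the relation for the sum, so a nonzero common eigenvector remains
    at the end and [a] is a sum of naturals. *)
Lemma eigenvalue_sum_commuting (F : fieldType) (V : lmodType F) (I : finType)
    (A : I -> {linear V -> V}) (m : I -> nat) (a : F) (v : V) :
  (forall i j w, A i (A j w) = A j (A i w)) ->
  (forall i w, A i (A i w) = A i w *+ m i) ->
  v != 0 -> \sum_i A i v = a *: v -> exists k : nat, a = k%:R.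
Proof.
move=> AC AA nz_v Av.
have /(_ (enum I)) [w [nz_w Aw ev]] : forall s : seq I, exists w : V,
    [/\ w != 0, \sum_i A i w = a *: w
      & forall i, i \in s -> exists k : nat, A i w = k%:R *: w].
  elim=> [|i s [w [nz_w Aw ev]]]; first by exists v; split.
  have [Aiw0 | nz_Aiw] := eqVneq (A i w) 0.
    exists w; split=> // j; rewrite inE => /orP[/eqP-> | /ev //].
    by exists 0%N; rewrite scale0r.
  exists (A i w); split=> //.
    by rewrite -linearZ -Aw linear_sum; apply: eq_bigr => j _; apply: AC.
  move=> j; rewrite inE => /orP[/eqP-> | /ev[k Ajw]].
    by exists (m i); rewrite AA scaler_nat.
  by exists k; rewrite AC Ajw linearZ.
have [k Ak] := fin_all_exists (fun i => ev i (mem_enum I i)).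
exists (\sum_i k i)%N; apply/eqP; rewrite -subr_eq0.
have : (a - (\sum_i k i)%:R) *: w = 0.
  rewrite scalerBl -Aw natr_sum scaler_suml -sumrB big1 // => i _.
  by rewrite Ak subrr.
by move/eqP; rewrite scaler_eq0 (negPf nz_w) orbF.
Qed.

(** * Summation over one coordinate of a function on a product *)

Section CoordinateSum.

Variables (F : fieldType) (I : finType) (Y : I -> finType).
Implicit Types (x : {dffun forall i, Y i}) (f : {ffun {dffun forall i, Y i} -> F^o}).

Definition update x i (z : Y i) : {dffun forall i, Y i} :=
  [ffun j => dfwith x z j].

Lemma update_in x i (z : Y i) : update x z i = z.
Proof. by rewrite ffunE dfwith_in. Qed.

Lemma update_out x i (z : Y i) j : j != i -> update x z j = x j.
Proof. by move=> ne; rewrite ffunE dfwith_out // eq_sym. Qed.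

Lemma update_update x i (z t : Y i) : update (update x z) t = update x t.
Proof.
apply/ffunP=> j; have [-> | ne] := eqVneq j i; first by rewrite !update_in.
by rewrite !update_out.
Qed.

Lemma updateC x i j (z : Y i) (t : Y j) :
  i != j -> update (update x z) t = update (update x t) z.
Proof.
move=> ij; apply/ffunP=> k; have [-> | ki] := eqVneq k i.
  by rewrite update_in update_out ?update_in.
have [-> | kj] := eqVneq k j; last by rewrite !update_out.
by rewrite update_in update_out ?update_in // eq_sym.
Qed.

(** The operator c_i^-1 B_i, for arbitrary scalars [c]. The codomain [F^o] makes the functions a
    vector space over [F]. *)
Definition scaled_fiber_sum (c : I -> nat) i f : {ffun {dffun forall i, Y i} -> F^o} :=
  [ffun x => (c i)%:R^-1 * \sum_(z : Y i) f (update x z)].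

Lemma scaled_fiber_sum_linear c i : linear (scaled_fiber_sum c i).
Proof.
move=> b f g; apply/ffunP=> x; rewrite !ffunE scalerAr -mulrDr; congr (_ * _).
by rewrite scaler_sumr -big_split; apply: eq_bigr => z _; rewrite !ffunE.
Qed.

HB.instance Definition _ c i := GRing.isLinear.Build F
  {ffun {dffun forall i, Y i} -> F^o} {ffun {dffun forall i, Y i} -> F^o} _
  (scaled_fiber_sum c i) (scaled_fiber_sum_linear c i).

Lemma scaled_fiber_sumC c i j f :
  scaled_fiber_sum c i (scaled_fiber_sum c j f) = scaled_fiber_sum c j (scaled_fiber_sum c i f).
Proof.
have [-> // | ij] := eqVneq i j; apply/ffunP=> x; rewrite !ffunE.
under eq_bigr do rewrite ffunE; rewrite -mulr_sumr mulrCA.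
under [in RHS]eq_bigr do rewrite ffunE; rewrite -mulr_sumr; congr (_ * (_ * _)).
by rewrite exchange_big; do 2!apply: eq_bigr => ? _; rewrite updateC.
Qed.

(** The inner sum no longer depends on coordinate [i], so the outer one only multiplies it by
    [#|Y i|]; divisibility makes the quotient by [c i] a natural number. *)
Lemma scaled_fiber_sumK c i f :
    (c i)%:R != 0 :> F -> (c i %| #|Y i|)%N ->
  scaled_fiber_sum c i (scaled_fiber_sum c i f) = scaled_fiber_sum c i f *+ (#|Y i| %/ c i).
Proof.
move=> nz_c c_dvd; apply/ffunP=> x; rewrite ffunMnE !ffunE.
under eq_bigr => z _.
  rewrite ffunE; under eq_bigr do rewrite update_update.
over.
rewrite sumr_const -[RHS]mulrnAr; congr (_ * _).
by rewrite -[in LHS](divnK c_dvd) mulrnA -[(_ *+ c i)]mulr_natl -mulrnAr mulVKf.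
Qed.

End CoordinateSum.

(** * Faces of the join as restricted tuples, their orbits, and the constants c_i *)

Section Faces.

Variables (gT : finGroupType) (n : nat) (Y : 'I_n -> finType).
Variable (to : forall i : 'I_n, {action gT &-> Y i}).
Implicit Types (x y : {dffun forall i, Y i}) (S T : {set 'I_n}).

(** Facets are the case [S = setT], and the facet of [x] with its vertex in [Y i] removed is the
    case [S = [set~ i]]. *)
Definition face S x : {set vertex Y} := [set Tagged Y (x i) | i in S].

Definition point_act x g : {dffun forall i, Y i} := [ffun i => to i (x i) g].

Lemma Tagged_point_inj x : injective (fun i => Tagged Y (x i)).
Proof. by move=> i j /(congr1 (@tag _ _)). Qed.

Lemma mem_face S x v : (v \in face S x) = (tag v \in S) && (tagged v == x (tag v)).
Proof.
case: v => i z /=; apply/imsetP/andP=> [[j Sj /eqP] | [Si /eqP->]].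
  rewrite -tag_eqE /tag_eq /= => /andP[/eqP eij]; case: _ / eij Sj => Sj.
  by rewrite tagged_asE => ->.
by exists i.
Qed.

Lemma face_inj S T x y : face S x = face T y -> S = T /\ {in S, forall i, x i = y i}.
Proof.
move=> /setP E.
have {}E (i : 'I_n) (z : Y i) :
  (Tagged Y z \in face S x) = (Tagged Y z \in face T y) by [].
split=> [|i Si].
  apply/setP=> i; have := (E i (x i), E i (y i)).
  rewrite !mem_face /= !eqxx !andbT => -[]; case: (i \in T) => [_ | -> //].
  by case: (i \in S).
by have := E i (x i); rewrite !mem_face /= Si eqxx => /esym/andP[_ /eqP].
Qed.

Lemma eq_face S x y : {in S, forall i, x i = y i} -> face S x = face S y.
Proof. by move=> xy; apply: eq_in_imset => i /xy->. Qed.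

Lemma face_act S x g : ((vertex_action to)^*)%act (face S x) g = face S (point_act x g).
Proof.
rewrite /= /setact /face -imset_comp; apply: eq_imset => i /=.
by rewrite /vertex_act /= ffunE.
Qed.

Lemma face_orbitP S T x y :
  reflect (S = T /\ exists g, {in S, forall i, to i (x i) g = y i})
          (face_orbit to (face S x) == face_orbit to (face T y)).
Proof.
rewrite eq_sym orbit_eq_mem; apply: (iffP orbitP) => [[g _] | [<- [g xy]]].
  rewrite face_act => /face_inj[<- xy]; split=> //; exists g => i /xy.
  by rewrite ffunE.
exists g; rewrite ?inE // face_act; apply: eq_face => i /xy.
by rewrite ffunE.
Qed.

Lemma mem_quotient_faces S x k :
  #|S| = k -> face_orbit to (face S x) \in quotient_faces to k.
Proof.
move=> Sk; apply: imset_f; rewrite inE card_imset ?Sk ?eqxx ?andbT.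
  apply/forallP=> -[i z]; apply/implyP; rewrite mem_face => /andP[_ /= /eqP->].
  apply/forallP=> -[j t]; apply/implyP; rewrite mem_face => /andP[_ /= /eqP->].
  by apply/implyP=> /eqP->.
exact: Tagged_point_inj.
Qed.

Lemma join_face_tag_inj (F : {set vertex Y}) : join_face F -> {in F &, injective (@tag _ _)}.
Proof.
move=> joinF v w Fv Fw /eqP tvw.
by have /forall_inP/(_ v Fv)/forall_inP/(_ w Fw)/implyP/(_ tvw)/eqP := joinF.
Qed.

Lemma card_join_face (F : {set vertex Y}) : join_face F -> (#|F| <= n)%N.
Proof.
move=> /join_face_tag_inj/card_in_imset <-.
by rewrite -[X in (_ <= X)%N]card_ord max_card.
Qed.

(** Tags are injective on a face, so a face with [n] vertices meets every [Y i], and its vertices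
    assemble into a tuple. *)
Lemma top_faceE F : join_face F -> #|F| = n -> exists x, F = face setT x.
Proof.
move=> joinF cardF.
have tagF := join_face_tag_inj joinF.
have imF : [set tag v | v in F] = setT.
  by apply/eqP; rewrite eqEcard subsetT cardsT card_ord card_in_imset ?cardF /=.
have [x Fx] : exists x : forall i, Y i, forall i, Tagged Y (x i) \in F.
  apply: (fin_all_exists (P := fun i z => Tagged Y z \in F)) => i.
  have: i \in [set tag v | v in F] by rewrite imF inE.
  by case/imsetP=> -[j z] Fz ->; exists z.
exists [ffun i => x i]; apply/esym/eqP.
rewrite eqEcard card_imset ?cardsT ?card_ord ?cardF ?leqnn ?andbT; last exact: Tagged_point_inj.
by apply/subsetP=> _ /imsetP[i _ ->]; rewrite ffunE.
Qed.

Lemma quotient_faces_topE O :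
  O \in quotient_faces to n -> exists x, O = face_orbit to (face setT x).
Proof.
case/imsetP=> F; rewrite inE => /andP[joinF /eqP cardF] ->.
by have [x ->] := top_faceE joinF cardF; exists x.
Qed.

Lemma face_setD1 S x i : face S x :\ Tagged Y (x i) = face (S :\ i) x.
Proof.
apply/setP=> v; rewrite in_setD1 !mem_face in_setD1 andbA.
apply: andb_id2r => /eqP xv; congr (~~ _ && _).
by apply/eqP/eqP=> [-> // | <-]; rewrite -xv; case: v {xv}.
Qed.

(** The sign of the [i]-th boundary term depends on [i] alone, so the signs cancel when the
    boundaries of two facets are multiplied. *)
Lemma vertex_rank_top x i :
  vertex_rank (face setT x) (Tagged Y (x i)) = #|[set j : 'I_n | (j < i)%N]|.
Proof.
rewrite -(card_imset _ (@Tagged_point_inj x)); apply: eq_card => w.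
by rewrite !inE (mem_face [set j | _]) mem_face !inE /= andbC.
Qed.

Definition others_fixer (i : 'I_n) : {group gT} :=
  (\bigcap_(j | j != i) 'C([set: Y j] | to j))%G.

(** The constant c_i, given as an index so that no point of [Y i] has to be chosen. The index counts
    the cosets of the kernel on [Y i] that meet [others_fixer i], hence is taken relative to the
    intersection of the two groups. *)
Definition fiber_orbit_card (i : 'I_n) : nat :=
  #|others_fixer i : 'C([set: Y i] | to i)%g|%g.

Hypothesis free : forall i, effectively_free (to i).

Lemma fix1_fix i (z t : Y i) g : to i z g = z -> to i t g = t.
Proof. by move=> fix_z; apply: (proj1 (effectively_freeP (to i)) (@free i) z). Qed.

(** By effective freeness, fixing the single point [x j] forces [g] to fix all of [Y j]; so the
    stabiliser of the other coordinates is the same for every [x]. *)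
Lemma mem_others_fixer x i g :
  reflect (forall j, j != i -> to j (x j) g = x j) (g \in others_fixer i).
Proof.
apply: (iffP bigcapP) => [fix_g j /fix_g/astab_act-> // | fix_g j ij].
by apply/astabP=> z _; apply: fix1_fix (fix_g j ij).
Qed.

(** Effective freeness makes the stabiliser of [z] equal to the kernel on [Y i], so the orbit size
    is independent of [z]. *)
Lemma card_orbit_others_fixer i (z : Y i) :
  #|orbit (to i) (others_fixer i) z| = fiber_orbit_card i.
Proof.
rewrite card_orbit /fiber_orbit_card -[RHS]indexgI; congr #|_ : _ :&: _|%g.
apply/setP=> g; apply/idP/idP=> [/astab1P fix_g | fix_g].
  by apply/astabP=> t _; apply: fix1_fix fix_g.
by apply/astab1P; apply: (astab_act fix_g).
Qed.

(** The orbits of [others_fixer i] partition [Y i] into blocks of this common size. *)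
Lemma dvdn_fiber_orbit_card i : (fiber_orbit_card i %| #|Y i|)%N.
Proof.
rewrite -cardsT (@card_uniform_partition _ (fiber_orbit_card i)
  [set orbit (to i) (others_fixer i) z | z in setT]) ?dvdn_mull //.
  by move=> _ /imsetP[z _ ->]; apply: card_orbit_others_fixer.
by apply: orbit_partition; apply/actsP=> g _ z; rewrite !inE.
Qed.

(* Acting on [y], we may assume that [x] and [y] differ at [i] only; the
   admissible [z] then form the orbit of [y i] under [others_fixer i]. *)
Lemma card_update_orbit x y i :
  #|[set z : Y i | face_orbit to (face setT (update x z)) == face_orbit to (face setT y)]|
  = (fiber_orbit_card i *
     (face_orbit to (face [set~ i] y) == face_orbit to (face [set~ i] x)))%N.
Proof.
case: face_orbitP => [[_ [g yx]] | nyx]; last first.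
  rewrite muln0; apply: eq_card0 => z; rewrite inE eq_sym; apply/face_orbitP=> -[_ [g yx]].
  case: nyx; split=> //; exists g => j; rewrite !inE => ji.
  by rewrite yx ?inE // update_out.
have {}yx j : j != i -> to j (y j) g = x j by move=> ji; apply: yx; rewrite !inE.
rewrite muln1 -(card_orbit_others_fixer (to i (y i) g)); apply: eq_card => z.
rewrite inE eq_sym; apply/face_orbitP/orbitP=> [[_ [h yxz]] | [h /(mem_others_fixer x) fix_h <-]].
  exists (g^-1 * h)%g; last by rewrite actM actK yxz ?inE // update_in.
  apply/(mem_others_fixer x) => j ji.
  by rewrite -{1}(yx j ji) actM actK yxz ?inE // update_out.
split=> //; exists (g * h)%g => j _; rewrite actM.
have [-> | ji] := eqVneq j i; first by rewrite update_in.
by rewrite update_out // yx // fix_h.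
Qed.

End Faces.

(** * The top Laplacian, for [n.+1] sets so that the top dimension is [n] *)

Section TopLaplacian.

Variables (C : numFieldType) (gT : finGroupType) (n : nat).
Variable Y : 'I_n.+1 -> finType.
Variable (to : forall i, {action gT &-> Y i}).
Implicit Types x y : {dffun forall i, Y i}.

Lemma face_vector_dot k (O O' : {set {set vertex Y}}) :
    O \in quotient_faces to k ->
  \sum_r face_vector to C k O r 0 * face_vector to C k O' r 0 = (O == O')%:R.
Proof.
move=> kO; rewrite (bigD1 (enum_rank_in kO O)) //= !mxE enum_rankK_in // eqxx mul1r.
rewrite big1 ?addr0 // => r neqr; rewrite mxE.
rewrite (negPf (_ : enum_val r != O)) ?mul0r //.
by apply: contraNneq neqr => rO; apply/eqP/enum_val_inj; rewrite enum_rankK_in.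
Qed.

Lemma face_boundary_top x :
  face_boundary to C n (face setT x) =
  \sum_(i < n.+1) (-1) ^+ #|[set j : 'I_n.+1 | (j < i)%N]| *:
    face_vector to C n (face_orbit to (face [set~ i] x)).
Proof.
rewrite /face_boundary big_imset /=; last by move=> i j _ _; apply: Tagged_point_inj.
apply: eq_big => [i | i _]; first by rewrite inE.
by rewrite vertex_rank_top face_setD1 setTD.
Qed.

Lemma card_setC1_ord (i : 'I_n.+1) : #|[set~ i]| = n.
Proof. by rewrite cardsC1 card_ord. Qed.

(** In the expanded product the terms with distinct omitted indices vanish, because the action
    preserves tags and such faces lie in different orbits; in the remaining terms the sign is
    squared. *)
Lemma face_boundary_top_dot x y :
  \sum_r face_boundary to C n (face setT x) r 0 * face_boundary to C n (face setT y) r 0 =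
  \sum_i (face_orbit to (face [set~ i] x) == face_orbit to (face [set~ i] y))%:R.
Proof.
under eq_bigr => r _.
  rewrite !face_boundary_top !summxE big_distrlr /=.
  under eq_bigr do under eq_bigr do rewrite [X in X * _]mxE [X in _ * X]mxE mulrACA.
over.
rewrite exchange_big; apply: eq_bigr => i _; rewrite exchange_big /=.
under eq_bigr do rewrite -mulr_sumr face_vector_dot ?mem_quotient_faces ?card_setC1_ord //.
rewrite (bigD1 i) //= -expr2 sqrr_sign mul1r big1 ?addr0 // => j ji.
case: face_orbitP => [[/setP/(_ j)]|]; last by rewrite mulr0.
by rewrite !inE ji eqxx.
Qed.

Lemma laplacian_top s t x y :
    enum_val s = face_orbit to (face setT x) ->
    enum_val t = face_orbit to (face setT y) ->
  laplacian to C n s t =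
  \sum_i (face_orbit to (face [set~ i] x) == face_orbit to (face [set~ i] y))%:R.
Proof.
move=> sx ty; rewrite -face_boundary_top_dot -(boundaryE C sx) -(boundaryE C ty).
(* A face has at most [n.+1] vertices, so the summand coming from the next boundary map is a sum
   over an empty index set. *)
have top0 : #|quotient_faces to n.+2| = 0%N.
  apply: eq_card0 => O; apply/imsetP=> -[F]; rewrite inE => /andP[/card_join_face leF].
  by move=> /eqP eqF; rewrite eqF ltnn in leF.
rewrite /laplacian !mxE [X in _ + X]big1 ?addr0; last first.
  by move=> r; have := ltn_ord r; rewrite [X in (_ < X)%N]top0.
by apply: eq_bigr => r _; rewrite !mxE.
Qed.

Lemma eigenvalue_top_laplacian (a : C) :
    (forall i, effectively_free (to i)) ->
  eigenvalue (laplacian to C n) a -> exists k : nat, a = k%:R.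
Proof.
move=> free /eigenvalueP[v vL nz_v].
(* [y] picks a tuple in each top orbit, and [cls] below is the orbit map on tuples; [f] is the row
   eigenvector [v] pulled back along [cls]. *)
have [y yE] := fin_all_exists (fun s : 'I_#|quotient_faces to n.+1| =>
  quotient_faces_topE (enum_valP s)).
pose c := fiber_orbit_card to.
have [cls clsE] : exists cls : {dffun forall i, Y i} -> 'I_#|quotient_faces to n.+1|,
    forall x, enum_val (cls x) = face_orbit to (face setT x).
  apply: (fin_all_exists (P := fun x s => enum_val s = face_orbit to (face setT x))) => x.
  have topx : face_orbit to (face setT x) \in quotient_faces to n.+1.
    by apply: mem_quotient_faces; rewrite cardsT card_ord.
  by exists (enum_rank_in topx (face_orbit to (face setT x))); rewrite enum_rankK_in.
pose f : {ffun {dffun forall i, Y i} -> C^o} := [ffun x => v 0 (cls x)].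
have nz_c i : (c i)%:R != 0 :> C by rewrite pnatr_eq0 -lt0n indexg_gt0.
apply: (@eigenvalue_sum_commuting _ _ _ (fun i => scaled_fiber_sum c i)
  (fun i => #|Y i| %/ c i)%N _ f).
- by move=> i j w; apply: scaled_fiber_sumC.
- by move=> i w; apply: scaled_fiber_sumK; last exact: dvdn_fiber_orbit_card.
(* Pullback is injective, since each orbit [s] is reached by the tuple [y s]. *)
- apply: contraNneq nz_v => /ffunP f0; apply/eqP/rowP=> s.
  have := f0 (y s); rewrite !ffunE mxE => <-; congr (v 0 _).
  by apply: enum_val_inj; rewrite clsE.
apply/ffunP=> x; transitivity (a * v 0 (cls x)); last by rewrite !ffunE.
(* The eigenvalue equation is read at the column [cls x], and the coordinates [i] are then compared
   one at a time. *)
have /rowP/(_ (cls x)) := vL; rewrite sum_ffunE !mxE => <-.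
under [in RHS]eq_bigr do rewrite (laplacian_top (yE _) (clsE x)) mulr_sumr.
rewrite exchange_big /=; apply: eq_bigr => i _; rewrite ffunE.
(* Group the values [z] of coordinate [i] by the orbit [s] of the updated tuple. By
   [card_update_orbit] each group has [c i] elements or none, according to the [i]-th term of the
   matrix entry, and this [c i] cancels the scaling factor. *)
rewrite (partition_big (fun z => cls (update x z)) predT) //= mulr_sumr.
apply: eq_bigr => s _.
under eq_bigr do rewrite ffunE.
have -> : \sum_(z : Y i | cls (update x z) == s) v 0 (cls (update x z)) =
    \sum_(z in [set z : Y i | face_orbit to (face setT (update x z))
                              == face_orbit to (face setT (y s))]) v 0 s.
  apply: eq_big => [z | z /eqP-> //].
  by rewrite inE -clsE -yE (inj_eq enum_val_inj).
by rewrite sumr_const card_update_orbit // -[v 0 s *+ _]mulr_natr natrM mulrCA mulKf.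
Qed.

End TopLaplacian.

Theorem theorem11p3 (R : realType) (gT : finGroupType) (n : nat)
    (Y : 'I_n -> finType) (to : forall i : 'I_n, {action gT &-> Y i}) :
  (0 < n)%N ->
  (forall i : 'I_n, effectively_free (to i)) ->
  forall a : R[i],
    eigenvalue (laplacian to R[i] n.-1) a -> exists m : int, a = m%:~R.
Proof.
(* Writing the number of sets as a successor turns [n.-1] into the top dimension treated above,
   where the eigenvalue is even a natural number. *)
case: n Y to => // n Y to _ free a /(eigenvalue_top_laplacian free)[k ->].
by exists k%:Z.
Qed.
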